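(* Let $a,b\ge1$ be integers. Then: (a) $r(I_p)<\min\{a,b\}$ for all $p\in H^+_{a,b}$. (b) $r(I_q)\le r(I_p)$ for all $p,q\in H^+_{a,b}$ with $q\ge p$.
   Context: $K$ is a field. $H^+_{a,b}=\{(c,d) : c,d \text{ nonnegative integers},\ bc+ad\ge ab\}$. For $p=(c,d)\in H^+_{a,b}$ put $u_p=x^cy^d$ and $I_p=(x^a,y^b,x^cy^d)\subset K[x,y]$. With $J=(x^a,y^b)$, the reduction number $r(I_p)$ is the smallest integer $r\ge0$ with $I_p^{r+1}=JI_p^r$ (such $r$ exists). The order on pairs is componentwise: $(e,f)\ge(c,d)$ means $e\ge c$ and $f\ge d$. *)

(* Defs.v *)
From mathcomp Require Import all_boot all_order all_algebra.
From mathcomp Require Import classical_sets.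
From mathcomp Require Import mpoly.

Set Implicit Arguments.
Unset Strict Implicit.
Unset Printing Implicit Defensive.

Import GRing.Theory.
Local Open Scope classical_set_scope.
Local Open Scope ring_scope.

(* Ideals are sets of ring elements, so that equality of ideals is Leibniz
   equality.  The structure idealr of ring_quotient is not usable here: it
   requires boolean membership and excludes the unit ideal, which is the
   zeroth power of every ideal. *)

Definition ideal_gen (R : comNzRingType) (S : set R) : set R :=
  [set f | exists2 s : seq (R * R),
     (forall t, t \in s -> S t.2) & f = \sum_(t <- s) t.1 * t.2].

Definition ideal_mul (R : comNzRingType) (I J : set R) : set R :=
  ideal_gen [set f * g | f in I & g in J].

Definition ideal_pow (R : comNzRingType) (I : set R) (n : nat) : set R :=
  iter n (ideal_mul I) [set: R].

(* r is the least natural number with I^(r+1) = J I^r.  This is a relation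
   rather than a function so that no junk value arises when no such number
   exists; there is at most one such r. *)
Definition is_reduction_number (R : comNzRingType) (J I : set R) (r : nat) :
    Prop :=
  ideal_pow I r.+1 = ideal_mul J (ideal_pow I r) /\
  forall s : nat,
    ideal_pow I s.+1 = ideal_mul J (ideal_pow I s) -> (r <= s)%N.

Definition Hplus (a b : nat) : set (nat * nat) :=
  [set p | (a * b <= b * p.1 + a * p.2)%N].

Section MonomialIdeals.
Variable K : fieldType.

(* x and y are the variables of K[x,y] indexed by ord0 and ord_max in 'I_2. *)
Definition xvar : {mpoly K[2]} := 'X_ord0.
Definition yvar : {mpoly K[2]} := 'X_ord_max.

Definition umon (p : nat * nat) : {mpoly K[2]} := xvar ^+ p.1 * yvar ^+ p.2.

Definition Jideal (a b : nat) : set {mpoly K[2]} :=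
  ideal_gen [set xvar ^+ a; yvar ^+ b].

Definition Iideal (a b : nat) (p : nat * nat) : set {mpoly K[2]} :=
  ideal_gen [set xvar ^+ a; yvar ^+ b; umon p].

End MonomialIdeals.

Arguments Jideal K a b : clear implicits.
Arguments Iideal K a b p : clear implicits.

(* Main.v *)
Require Import Defs.
From mathcomp Require Import all_boot all_order all_algebra.
From mathcomp Require Import classical_sets.
From mathcomp Require Import mpoly.
From mathcomp Require Import zify ring.

(** Write [u = x^c y^d], [I = J + (u)].  Expanding powers of [I] gives
    [I^(r+1) = J I^r + (u^(r+1))], so [r] satisfies the reduction equation iff
    [u^(r+1)] lies in [J I^r].  This is a monomial ideal, generated by the
    [x^(ai) y^(bj) u^k] with [i + j + k = r + 1] and [i + j > 0].  Cancelling
    [u^k], membership says that some [m] with [0 < m <= r + 1] splits as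
    [m = i + j] with [a i <= m c] and [b j <= m d], that is, satisfies
    [m <= floor (m c / a) + floor (m d / b)] (lemma [reduction_eqP]).

    Hence [r(I_p) + 1] is the least positive [m] for which this inequality
    holds.  The right-hand side is monotone in [(c, d)], which gives (b).  The
    inequality holds at [m = a] and at [m = b] because it then reduces to
    [b c + a d >= a b]; this gives (a). *)

Set Implicit Arguments.
Unset Strict Implicit.
Unset Printing Implicit Defensive.

Import GRing.Theory.
Local Open Scope classical_set_scope.
Local Open Scope ring_scope.

(** * Ideals as sets *)

Section Ideals.
Variable R : comNzRingType.
Implicit Types (S I J A : set R) (f g u : R) (n : nat).

Definition is_ideal A : Prop :=
  [/\ A 0, forall f g, A f -> A g -> A (f + g) & forall h f, A f -> A (h * f)].

Lemma ideal_gen_is_ideal S : is_ideal (ideal_gen S).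
Proof.
split.
- by exists [::]; rewrite ?big_nil // => t.
- move=> f g [s hs ->] [t ht ->]; exists (s ++ t); last by rewrite big_cat.
  by move=> z; rewrite mem_cat => /orP[/hs|/ht].
- move=> h f [s hs ->]; exists [seq (h * t.1, t.2) | t <- s].
    by move=> _ /mapP[t ts ->]; apply: (hs t).
  by rewrite big_map mulr_sumr; apply: eq_bigr => t _; rewrite mulrA.
Qed.

Lemma sub_ideal_gen S : S `<=` ideal_gen S.
Proof.
move=> f Sf; exists [:: (1, f)]; last by rewrite big_seq1 mul1r.
by move=> t; rewrite inE => /eqP->.
Qed.

Lemma ideal_gen_min S A : is_ideal A -> S `<=` A -> ideal_gen S `<=` A.
Proof.
move=> [A0 AD AM] SA _ [s hs ->]; rewrite big_seq.
by apply: (big_ind A) => // t ts; apply/AM/SA/hs.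
Qed.

Lemma ideal_genS S1 S2 : S1 `<=` S2 -> ideal_gen S1 `<=` ideal_gen S2.
Proof.
move=> S12; apply: ideal_gen_min; first exact: ideal_gen_is_ideal.
by move=> f /S12; apply: sub_ideal_gen.
Qed.

Lemma mem_ideal_mul I J f g : I f -> J g -> ideal_mul I J (f * g).
Proof. by move=> If Jg; apply: sub_ideal_gen; exists f => //; exists g. Qed.

Lemma ideal_mul_min I J A :
  is_ideal A -> (forall f g, I f -> J g -> A (f * g)) -> ideal_mul I J `<=` A.
Proof.
by move=> Aid IJA; apply: ideal_gen_min => // _ [f If [g Jg <-]]; apply: IJA.
Qed.

Lemma ideal_mulSl I J A : I `<=` J -> ideal_mul I A `<=` ideal_mul J A.
Proof.
move=> IJ; apply: ideal_mul_min; first exact: ideal_gen_is_ideal.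
by move=> f g /IJ Jf Ag; apply: mem_ideal_mul.
Qed.

(** The ideal [A + (u)].  It is used with [A = J], where [J + (u) = I], and
    with [A = J I^n] and [u^(n+1)] in place of [u]. *)
Definition add_principal A u : set R :=
  [set f | exists2 g, A g & exists h, f = g + h * u].

Lemma add_principal_is_ideal A u : is_ideal A -> is_ideal (add_principal A u).
Proof.
move=> [A0 AD AM]; split.
- by exists 0 => //; exists 0; rewrite mul0r addr0.
- move=> _ _ [f Af [h ->]] [g Ag [k ->]].
  by exists (f + g); [apply: AD | exists (h + k); ring].
- move=> l _ [f Af [h ->]].
  by exists (l * f); [apply: AM | exists (l * h); ring].
Qed.

Lemma ideal_gen_setU1 S u :
  ideal_gen (S `|` [set u]) `<=` add_principal (ideal_gen S) u.
Proof.
have Sid := ideal_gen_is_ideal S.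
apply: ideal_gen_min => [|f [Sf|->]]; first exact: add_principal_is_ideal.
  by exists f; [apply: sub_ideal_gen | exists 0; rewrite mul0r addr0].
by case: Sid => S0 _ _; exists 0 => //; exists 1; rewrite mul1r add0r.
Qed.

Section OneMoreGenerator.
Variables (S : set R) (u : R).
Let J := ideal_gen S.
Let I := ideal_gen (S `|` [set u]).

Let subJI : J `<=` I.
Proof. by apply: ideal_genS => f; left. Qed.

Let Iu : I u.
Proof. by apply: sub_ideal_gen; right. Qed.

Lemma mem_ideal_pow_exp f n k g :
  I f -> ideal_pow I n g -> ideal_pow I (k + n) (f ^+ k * g).
Proof.
move=> If Ig; elim: k => [|k IHk]; first by rewrite mul1r.
by rewrite exprS -mulrA; apply: mem_ideal_mul.
Qed.

(** [I * (J I^n)] lies in [J I^(n+1)]: the factor from [I] is moved past [J]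
    and absorbed in the power of [I]. *)
Lemma ideal_mul_powS f n g : I f ->
  ideal_mul J (ideal_pow I n) g -> ideal_mul J (ideal_pow I n.+1) (f * g).
Proof.
have [A0 AD AM] :=
  ideal_gen_is_ideal [set h * k | h in J & k in ideal_pow I n.+1].
move=> If.
apply: (@ideal_mul_min _ _ [set g | ideal_mul J (ideal_pow I n.+1) (f * g)]).
  split=> /=; first by rewrite mulr0.
    by move=> h k fh fk; rewrite mulrDr; apply: AD.
  by move=> h k fk; rewrite mulrCA; apply: AM.
move=> h k Jh Ik /=; rewrite mulrCA.
by apply: mem_ideal_mul => //; apply: mem_ideal_mul.
Qed.

(** Modulo [J I^n], every product of [n + 1] elements of [I] is a multiple of
    [u^(n+1)], since each other term of its expansion has a factor in [J]. *)
Lemma ideal_powS_sub n :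
  ideal_pow I n.+1 `<=`
    add_principal (ideal_mul J (ideal_pow I n)) (u ^+ n.+1).
Proof.
elim: n => [|n IHn];
  (apply: ideal_mul_min; first exact/add_principal_is_ideal/ideal_gen_is_ideal).
  move=> f g /ideal_gen_setU1[j Jj [h ->]] _.
  by exists (j * g); [apply: mem_ideal_mul | exists (h * g); ring].
move=> f g /ideal_gen_setU1[j Jj [h ->]] Ig.
have [v JIv [k Dg]] := IHn _ Ig.
have [_ AD AM] :=
  ideal_gen_is_ideal [set h * k | h in J & k in ideal_pow I n.+1].
exists (j * g + h * (u * v)); last by exists (h * k); rewrite Dg [u ^+ n.+2]exprS; ring.
by apply: AD; [apply: mem_ideal_mul | apply/AM/ideal_mul_powS].
Qed.

(** Since [I^(n+1) = J I^n + (u^(n+1))], the single element [u^(n+1)] decides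
    whether the two sides agree. *)
Lemma reduction_eq_mem n :
  ideal_pow I n.+1 = ideal_mul J (ideal_pow I n) <->
  ideal_mul J (ideal_pow I n) (u ^+ n.+1).
Proof.
split=> [<-|JIu].
  by have := @mem_ideal_pow_exp u 0 n.+1 1 Iu Logic.I; rewrite mulr1 addn0.
apply/seteqP; split; last exact: ideal_mulSl.
have [_ AD AM] := ideal_gen_is_ideal [set h * k | h in J & k in ideal_pow I n].
by move=> f /ideal_powS_sub[g JIg [h ->]]; apply: AD => //; apply: AM.
Qed.

Lemma mem_ideal_mul_powS s f n :
  S s -> ideal_pow I n f -> ideal_mul J (ideal_pow I n) (s * f).
Proof. by move=> Ss; apply: mem_ideal_mul; apply: sub_ideal_gen. Qed.

End OneMoreGenerator.
End Ideals.

(** * Monomial support *)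

Section MonomialSupport.
Variable K : fieldType.
Implicit Types (E : nat -> nat -> Prop) (f g : {mpoly K[2]}).

(** For an upward closed set [E] of exponents, this is the monomial ideal
    spanned by the monomials with exponent in [E]. *)
Definition supp_in E : set {mpoly K[2]} :=
  [set f | forall m, m \in msupp f -> E (m ord0) (m ord_max)].

Definition up_closed E : Prop :=
  forall e1 e2 e1' e2', (e1 <= e1')%N -> (e2 <= e2')%N -> E e1 e2 -> E e1' e2'.

Lemma supp_inM E1 E2 E f g :
  (forall c1 d1 c2 d2, E1 c1 d1 -> E2 c2 d2 -> E (c1 + c2)%N (d1 + d2)%N) ->
  supp_in E1 f -> supp_in E2 g -> supp_in E (f * g).
Proof.
move=> E12 E1f E2g m /msuppM_le /allpairsP[[m1 m2] /= [m1f m2g ->]].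
by rewrite !mnmDE; apply: E12; [apply: E1f | apply: E2g].
Qed.

Lemma supp_in_is_ideal E : up_closed E -> is_ideal (supp_in E).
Proof.
move=> Eup; split.
- by move=> m; rewrite msupp0.
- by move=> f g Ef Eg m /msuppD_le; rewrite mem_cat => /orP[/Ef|/Eg].
- move=> h f Ef; apply: (@supp_inM (fun _ _ => True) E) => //.
  by move=> c1 d1 c2 d2 _; apply: Eup; lia.
Qed.

Lemma umonE p : umon K p = 'X_[U_(ord0) *+ p.1 + U_(ord_max) *+ p.2].
Proof. by rewrite /umon /xvar /yvar !mpolyXn -mpolyXD. Qed.

Lemma umonD c d c' d' :
  umon K (c + c', d + d')%N = umon K (c, d) * umon K (c', d').
Proof. by rewrite /umon /= !exprD; ring. Qed.

Lemma umon_exp p n : umon K p ^+ n = umon K (n * p.1, n * p.2)%N.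
Proof. by rewrite /umon exprMn -!exprM !(mulnC n). Qed.

Lemma supp_in_umon E p : supp_in E (umon K p) <-> E p.1 p.2.
Proof.
have Ep m : m = (U_(ord0) *+ p.1 + U_(ord_max) *+ p.2)%MM :> 'X_{1..2} ->
    m ord0 = p.1 /\ m ord_max = p.2.
  by move=> ->; rewrite !mnmDE !mulmnE !mnm1E /=; lia.
split=> [Eu|Epp m].
  have [e1 e2] := Ep _ erefl; rewrite umonE in Eu.
  have := Eu (U_(ord0) *+ p.1 + U_(ord_max) *+ p.2)%MM.
  by rewrite msuppX inE eqxx e1 e2; apply.
by rewrite umonE msuppX inE => /eqP/Ep[-> ->].
Qed.

End MonomialSupport.

(** * The numerical criterion *)

Definition splits (a b : nat) (p : nat * nat) (m : nat) : bool :=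
  (m <= (m * p.1) %/ a + (m * p.2) %/ b)%N.

(** The floors are the largest admissible [i] and [j]; when they add up to
    more than [m], they can be lowered, so only their sum matters. *)
Lemma splitsP (a b : nat) (p : nat * nat) (m : nat) :
  (0 < a)%N -> (0 < b)%N ->
  reflect
    (exists i j,
       [/\ (i + j)%N = m, (i * a <= m * p.1)%N & (j * b <= m * p.2)%N])
    (splits a b p m).
Proof.
move=> a0 b0; apply: (iffP idP) => [sm|[i [j [<- hi hj]]]]; last first.
  by apply: leq_add; rewrite leq_divRL.
set i := minn m ((m * p.1) %/ a).
exists i, (m - i)%N; split; first by rewrite subnKC // geq_minl.
  by rewrite -leq_divRL // geq_minr.
rewrite -leq_divRL // leq_subLR; move: sm; rewrite /splits /i minnE.
by move: (_ %/ a)%N (_ %/ b)%N; lia.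
Qed.

Lemma splits_mono (a b : nat) (p q : nat * nat) (m : nat) :
  (p.1 <= q.1)%N -> (p.2 <= q.2)%N -> splits a b p m -> splits a b q m.
Proof.
move=> h1 h2 /leq_trans; apply; apply: leq_add; apply: leq_div2r;
  by rewrite leq_mul2l ?h1 ?h2 orbT.
Qed.

(** At [m = a] the first floor is exactly [c], so what is left to check is
    [a - c <= floor (a d / b)], that is [a b <= b c + a d]. *)
Lemma splits_fst (a b : nat) (p : nat * nat) :
  (0 < a)%N -> (0 < b)%N -> Hplus a b p -> splits a b p a.
Proof.
rewrite /Hplus /= => a0 b0 hp; rewrite /splits mulKn // -leq_subLR leq_divRL //.
nia.
Qed.

Lemma splits_snd (a b : nat) (p : nat * nat) :
  (0 < a)%N -> (0 < b)%N -> Hplus a b p -> splits a b p b.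
Proof.
move=> a0 b0 hp; rewrite /splits addnC; apply: (@splits_fst b a (p.2, p.1)) => //.
by move: hp; rewrite /Hplus /= mulnC addnC.
Qed.

Section Criterion.
Variables (K : fieldType) (a b : nat) (p : nat * nat).
Local Notation J := (Jideal K a b).
Local Notation I := (Iideal K a b p).

(** Exponents of the multiples of some [x^(ai) y^(bj) u^k] with
    [i + j + k = n] and [l <= i + j]: these span [I^n] for [l = 0], and
    [J I^(n-1)] for [l = 1]. *)
Definition pow_exponents (l n e f : nat) : Prop :=
  exists i j k, [/\ (i + j + k)%N = n, (l <= i + j)%N,
    (i * a + k * p.1 <= e)%N & (j * b + k * p.2 <= f)%N].

Lemma pow_exponents_up l n : up_closed (pow_exponents l n).
Proof.
move=> e f e' f' ee ff [i [j [k [h1 h2 h3 h4]]]].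
by exists i, j, k; split=> //; lia.
Qed.

Lemma pow_exponentsD l1 n1 l2 n2 e1 f1 e2 f2 :
  pow_exponents l1 n1 e1 f1 -> pow_exponents l2 n2 e2 f2 ->
  pow_exponents (l1 + l2) (n1 + n2) (e1 + e2) (f1 + f2).
Proof.
move=> [i [j [k [h1 h2 h3 h4]]]] [i' [j' [k' [h1' h2' h3' h4']]]].
by exists (i + i')%N, (j + j')%N, (k + k')%N; rewrite !mulnDl; split; lia.
Qed.

Let supp_pow_is_ideal l n := @supp_in_is_ideal K _ (@pow_exponents_up l n).

Let xvarE n : xvar K ^+ n = umon K (n, 0)%N.
Proof. by rewrite /umon mulr1. Qed.

Let yvarE n : yvar K ^+ n = umon K (0, n)%N.
Proof. by rewrite /umon mul1r. Qed.

Lemma Jideal_supp : J `<=` supp_in (pow_exponents 1 1).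
Proof.
apply: ideal_gen_min; first exact: supp_pow_is_ideal.
move=> f [->|->]; rewrite ?xvarE ?yvarE; apply/supp_in_umon => /=.
  by exists 1%N, 0%N, 0%N; split; lia.
by exists 0%N, 1%N, 0%N; split; lia.
Qed.

Lemma Iideal_supp : I `<=` supp_in (pow_exponents 0 1).
Proof.
apply: ideal_gen_min; first exact: supp_pow_is_ideal.
move=> f [[->|->]|->]; rewrite ?xvarE ?yvarE; apply/supp_in_umon => /=.
- by exists 1%N, 0%N, 0%N; split; lia.
- by exists 0%N, 1%N, 0%N; split; lia.
- by exists 0%N, 0%N, 1%N; split; lia.
Qed.

Lemma Iideal_pow_supp n : ideal_pow I n `<=` supp_in (pow_exponents 0 n).
Proof.
elim: n => [|n IHn]; first by move=> f _ m _; exists 0%N, 0%N, 0%N.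
apply: ideal_mul_min => [|f g /Iideal_supp If /IHn Ig]; first exact: supp_pow_is_ideal.
exact: (supp_inM (@pow_exponentsD 0 1 0 n) If Ig).
Qed.

Lemma Jideal_mul_supp n :
  ideal_mul J (ideal_pow I n) `<=` supp_in (pow_exponents 1 n.+1).
Proof.
apply: ideal_mul_min => [|f g /Jideal_supp Jf /Iideal_pow_supp Ig].
  exact: supp_pow_is_ideal.
exact: (supp_inM (@pow_exponentsD 1 1 0 n) Jf Ig).
Qed.

Lemma mem_Iideal_pow i j k :
  ideal_pow I (i + (j + k))
    ((xvar K ^+ a) ^+ i * ((yvar K ^+ b) ^+ j * umon K p ^+ k)).
Proof.
apply: mem_ideal_pow_exp; first by apply: sub_ideal_gen; left; left.
apply: mem_ideal_pow_exp; first by apply: sub_ideal_gen; left; right.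
have Iu : I (umon K p) by apply: sub_ideal_gen; right.
by have := mem_ideal_pow_exp k (n := 0) Iu (g := 1) Logic.I; rewrite mulr1 addn0.
Qed.

Lemma mem_Jideal_mul i j k n : (i + j + k)%N = n.+1 -> (0 < i + j)%N ->
  ideal_mul J (ideal_pow I n)
    ((xvar K ^+ a) ^+ i * ((yvar K ^+ b) ^+ j * umon K p ^+ k)).
Proof.
case: i j => [|i] [|j] // hn _.
- have -> : n = (0 + (j + k))%N by lia.
  rewrite mul1r exprS -mulrA; apply: mem_ideal_mul_powS; first by right.
  by have := mem_Iideal_pow 0 j k; rewrite mul1r.
- have -> : n = (i + (0 + k))%N by lia.
  rewrite exprS -mulrA.
  by apply: mem_ideal_mul_powS; [left | exact: mem_Iideal_pow].
- have -> : n = (i + (j.+1 + k))%N by lia.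
  rewrite exprS -mulrA.
  by apply: mem_ideal_mul_powS; [left | exact: mem_Iideal_pow].
Qed.

(** The equation for [r] holds iff [u^(r+1)] is divisible by a generator
    [x^(ai) y^(bj) u^k] of [J I^r]; the witness [m] is [i + j = r + 1 - k]. *)
Lemma reduction_eqP r : (0 < a)%N -> (0 < b)%N ->
  ideal_pow I r.+1 = ideal_mul J (ideal_pow I r) <->
  exists m, [/\ (0 < m)%N, (m <= r.+1)%N & splits a b p m].
Proof.
move=> a0 b0; rewrite reduction_eq_mem; split=> [/Jideal_mul_supp|].
  rewrite umon_exp => /supp_in_umon /= [i [j [k [h1 h2 h3 h4]]]].
  exists (i + j)%N; split; [lia | lia |].
  by apply/splitsP => //; exists i, j; split; nia.
move=> [m [m0 mr /splitsP[]// i [j [Dm hi hj]]]].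
have [_ _ AM] := ideal_gen_is_ideal [set f * g | f in J & g in ideal_pow I r].
have hn : (i + j + (r.+1 - m))%N = r.+1 by lia.
have ij0 : (0 < i + j)%N by lia.
(* The cofactor of the generator is what remains of u^m = x^(mc) y^(md) after
   dividing by x^(ia) y^(jb). *)
have := AM (umon K (m * p.1 - i * a, m * p.2 - j * b)%N) _ (mem_Jideal_mul hn ij0).
congr (ideal_mul _ _ _); rewrite -!exprM xvarE yvarE !umon_exp -!umonD.
by congr (umon K (_, _)); nia.
Qed.

End Criterion.

Theorem proposition4p2 (K : fieldType) (a b : nat) (ha : (1 <= a)%N) (hb : (1 <= b)%N) :
  (forall p : nat * nat, Hplus a b p ->
     exists2 r : nat,
       is_reduction_number (Jideal K a b) (Iideal K a b p) r & (r < minn a b)%N)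
  /\
  (forall p q : nat * nat, Hplus a b p -> Hplus a b q ->
     (p.1 <= q.1)%N -> (p.2 <= q.2)%N ->
     forall rp rq : nat,
       is_reduction_number (Jideal K a b) (Iideal K a b p) rp ->
       is_reduction_number (Jideal K a b) (Iideal K a b q) rq ->
       (rq <= rp)%N).
Proof.
split=> [p hp|p q _ _ h1 h2 rp rq [eqp _] [_ minq]]; last first.
  have [m [m0 mr sm]] := (reduction_eqP K p rp ha hb).1 eqp.
  apply/minq/reduction_eqP => //; exists m; split=> //.
  exact: splits_mono sm.
have sa := splits_fst ha hb hp; have sb := splits_snd ha hb hp.
have exs : exists n, splits a b p n.+1 by exists a.-1; rewrite prednK.
have [r sr minr] := ex_minnP exs.
exists r.
  split; first by apply/reduction_eqP => //; exists r.+1.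
  move=> s /reduction_eqP[]// m [m0 ms sm].
  by have := minr m.-1; rewrite prednK // => /(_ sm); lia.
have := minr a.-1; have := minr b.-1; rewrite !prednK // => /(_ sb) + /(_ sa).
by lia.
Qed.
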